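(* There are infinitely many CE-Pisot numbers $\beta$ for which the $\beta$-expansion of $1$ is finite but condition $(F_1)$, namely $\mathbb{N}\subset \mathrm{Fin}(\beta)$, does not hold.
   Context: For a real $\beta>1$ which is not an integer, the $\beta$-transformation is $T_\beta(x)=\beta x-\lfloor \beta x\rfloor$ on $[0,1]$. The $\beta$-expansion (greedy expansion) of $x\in[0,1]$ is the digit sequence $e_k(x)=\lfloor \beta T_\beta^{k-1}(x)\rfloor$, $k\ge1$, so that $x=\sum_{k\ge1}e_k(x)\beta^{-k}$; for $x>1$, letting $L$ be the least natural number with $x\le\beta^L$, the $\beta$-expansion of $x$ is the $\beta$-expansion of $x/\beta^L$ shifted $L$ places to the left. $\mathrm{Fin}(\beta)$ denotes the set of numbers whose $\beta$-expansion has only finitely many nonzero digits. A Pisot number is a real algebraic integer $\beta>1$ all of whose other Galois conjugates have modulus $<1$. Writing the finite $\beta$-expansion of $1$ as $a_1a_2\ldots a_n$ (i.e. $1=\sum_{i=1}^n a_i\beta^{-i}$, greedy digits, $a_n\neq 0$), $\beta$ is called a CE-Pisot number if it is a Pisot number whose expansion of $1$ is finite, the sequence $(a_i)_{1\le i\le n}$ is not monotonic, and $a_k=0$ for some $1<k<n$. *)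

(* Defs.v *)
From HB Require Import structures.
From mathcomp Require Import all_boot all_order all_algebra.
From mathcomp Require Import complex.
From mathcomp Require Import boolp classical_sets cardinality reals.

Set Implicit Arguments.
Unset Strict Implicit.
Unset Printing Implicit Defensive.

Import Order.TTheory GRing.Theory Num.Theory.
Local Open Scope classical_set_scope.
Local Open Scope ring_scope.
Local Open Scope complex_scope.

Definition beta_transform (R : realType) (b x : R) : R :=
  b * x - (Num.floor (b * x))%:~R.

(* Digits are indexed from 1, and the value at k = 0 is junk.  This is the
   beta-expansion of x only for 0 <= x <= 1. *)
Definition beta_digit (R : realType) (b x : R) (k : nat) : int :=
  Num.floor (b * iter k.-1 (beta_transform b) x).

Definition beta_shift (R : realType) (b x : R) (L : nat) : Prop :=
  x <= b ^+ L /\ forall M : nat, x <= b ^+ M -> (L <= M)%N.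

(* For x <= 1 the shift L is 0, so both cases of the definition of the
   beta-expansion are covered.  The digits of x are those of x / b ^+ L moved
   L places to the left, which does not change how many are nonzero. *)
Definition beta_Fin (R : realType) (b : R) : set R :=
  [set x | 0 <= x /\
    exists2 L : nat, beta_shift b x L &
      finite_set [set k | (0 < k)%N /\ beta_digit b (x / b ^+ L) k != 0]].

(* A monic irreducible rational polynomial vanishing at x is the minimal
   polynomial of x over the rationals. *)
Definition galois_conjugate (R : realType) (x : R) (z : R[i]) : Prop :=
  exists p : {poly rat},
    [/\ p \is monic, irreducible_poly p,
        root (map_poly ratr p) x & root (map_poly ratr p) z].

Definition pisot (R : realType) (b : R) : Prop :=
  [/\ 1 < b, integralOver (intr : int -> R) b &
      forall z : R[i], galois_conjugate b z -> z != b%:C -> `|z| < 1].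

Definition finite_expansion_one (R : realType) (b : R) (n : nat) : Prop :=
  [/\ (0 < n)%N, beta_digit b 1 n != 0 &
      forall k : nat, (n < k)%N -> beta_digit b 1 k = 0].

Definition monotonic (s : seq int) : bool :=
  sorted (fun x y => x <= y) s || sorted (fun x y => y <= x) s.

Definition CE_pisot (R : realType) (b : R) : Prop :=
  pisot b /\
  exists n : nat,
    [/\ finite_expansion_one b n,
        ~~ monotonic [seq beta_digit b 1 i | i <- iota 1 n] &
        exists2 k : nat, (1 < k < n)%N & beta_digit b 1 k = 0].

Definition condition_F1 (R : realType) (b : R) : Prop :=
  range (fun n : nat => n%:R : R) `<=` beta_Fin b.

(* Main.v *)
(* For n >= 2 let b be the root in (n, n + 1) of
   x ^ 4 - n x ^ 3 - (n - 1) x - 1.  The greedy expansion of 1 is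
   n 0 (n - 1) 1, and that of n + 1 is eventually periodic but infinite.  The
   cofactor of x - b is x ^ 3 + p x ^ 2 + q x + r, whose coefficients are the
   successive nonzero T_b-images of 1; writing a root z as
   z (z ^ 2 + q) = - (p z ^ 2 + r) and comparing moduli gives |z| < 1.  As n
   grows, these b are unbounded. *)
Require Import Defs.
From mathcomp Require Import all_boot all_order all_algebra.
From mathcomp Require Import boolp classical_sets cardinality reals.
From mathcomp Require Import complex ring lra zify.
Import Order.TTheory GRing.Theory Num.Theory.

Local Open Scope classical_set_scope.
Local Open Scope ring_scope.

(** * Conjugates and the modulus of roots of a cubic *)

(** The gcd vanishes at [x], hence is not constant, so irreducibility makes it associate to [p].
    This turns every conjugate of [b] into a root of the quartic, however the quartic factors over
    the rationals. *)
Lemma irreducible_common_root_dvdp (F K : fieldType) (f : {rmorphism F -> K})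
    (p q : {poly F}) (x : K) :
  irreducible_poly p -> root (map_poly f p) x -> root (map_poly f q) x ->
  p %| q.
Proof.
move=> [p_gt1 p_irr] px qx.
have gx : root (map_poly f (gcdp p q)) x by rewrite gcdp_map root_gcd px.
have g_neq1 : size (gcdp p q) != 1.
  apply/eqP => /eqP /size_poly1P[c c0 gE].
  by move: gx; rewrite gE map_polyC rootC fmorph_eq0 (negbTE c0).
have /eqp_dvdl <- := p_irr _ g_neq1 (dvdp_gcdl p q).
exact: dvdp_gcdr.
Qed.

(** If |z| >= 1, then z (z ^ 2 + q) outweighs p z ^ 2 + r. The bound on [p + r] settles the extreme
    case z ^ 2 = |z| ^ 2, the bound on |p - r| the case z ^ 2 = - |z| ^ 2. *)
Lemma cubic_root_normc_lt1 (R : rcfType) (p q r : R) (z : R[i]) :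
  0 <= p < 1 -> 0 <= q -> 0 <= r -> `|p - r| < 1 - q -> p + r < 1 + q ->
  z ^+ 3 + p%:C%C * z ^+ 2 + q%:C%C * z + r%:C%C = 0 -> `|z| < 1.
Proof.
move=> /andP[p0 p1] q0 r0; rewrite ltr_norml => /andP[prl prr] pr.
case: z => x y; rewrite !exprS expr0 mulr1.
move=> /eqP; rewrite eq_complex /= => /andP[/eqP Ere /eqP Eim].
rewrite normc_def /= ltcE /= eqxx /=.
rewrite ltNge; apply/negP => s1.
set s := x ^+ 2 + y ^+ 2 in s1.
have {}s1 : 1 <= s.
  have s0 : 0 <= s by rewrite addr_ge0 ?sqr_ge0.
  by rewrite -(sqr_sqrtr s0) exprn_ege1.
set u := x ^+ 2 - y ^+ 2; set v := 2 * x * y.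
(* The moduli of z (w + q) and of -(p w + r), where w = z ^ 2 = u + i v. *)
have E : s * (s ^+ 2 + 2 * q * u + q ^+ 2) =
         p ^+ 2 * s ^+ 2 + 2 * p * r * u + r ^+ 2.
  have -> : s * (s ^+ 2 + 2 * q * u + q ^+ 2) =
    (x * (u + q) - y * v) ^+ 2 + (x * v + y * (u + q)) ^+ 2.
    by rewrite /s /u /v; ring.
  have -> : x * (u + q) - y * v = - (p * u + r).
    by apply/eqP; rewrite -subr_eq0 opprK -[X in _ == X]Ere /u /v; apply/eqP; ring.
  have -> : x * v + y * (u + q) = - (p * v).
    by apply/eqP; rewrite -subr_eq0 opprK -[X in _ == X]Eim /u /v; apply/eqP; ring.
  by rewrite /s /u /v; ring.
have us : 0 <= s + u.
  by have -> : s + u = 2 * x ^+ 2; [rewrite /s /u; ring | rewrite mulr_ge0 ?sqr_ge0].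
have su : 0 <= s - u.
  by have -> : s - u = 2 * y ^+ 2; [rewrite /s /u; ring | rewrite mulr_ge0 ?sqr_ge0].
clearbody s u v; clear Ere Eim x y v.
(* The difference of both sides of E is affine in u, and positive for u = s
   and for u = - s. *)
have Fp : 0 < s * (s + q) ^+ 2 - (p * s + r) ^+ 2.
  have ps : 0 <= (1 - p) * (s - 1) by rewrite mulr_ge0 ?subr_ge0 ?(ltW p1).
  have ps0 : 0 <= p * s by rewrite mulr_ge0 ?(le_trans _ s1).
  have h : (p * s + r) ^+ 2 < (s + q) ^+ 2.
    by rewrite ltr_pXn2r ?nnegrE //; lra.
  have k : 0 <= (s - 1) * (s + q) ^+ 2 by rewrite mulr_ge0 ?sqr_ge0 ?subr_ge0.
  lra.
have Fn : 0 < s * (s - q) ^+ 2 - (p * s - r) ^+ 2.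
  have ps : 0 <= (1 - p) * (s - 1) by rewrite mulr_ge0 ?subr_ge0 ?(ltW p1).
  have ps0 : 0 <= p * (s - 1) by rewrite mulr_ge0 ?subr_ge0.
  have h : (p * s - r) ^+ 2 < (s - q) ^+ 2.
    rewrite -subr_gt0 subr_sqr mulr_gt0 //; lra.
  have k : 0 <= (s - 1) * (s - q) ^+ 2 by rewrite mulr_ge0 ?sqr_ge0 ?subr_ge0.
  lra.
(* Interpolation between the two extremes: the weights add up to [2 * s], so this sum is [2 * s]
   times the difference at [u], which [E] makes zero. *)
have : 0 < (s + u) * (s * (s + q) ^+ 2 - (p * s + r) ^+ 2) +
           (s - u) * (s * (s - q) ^+ 2 - (p * s - r) ^+ 2).
  have [u0|u0] := leP 0 u.
    by rewrite ltr_wpDr ?mulr_gt0 ?mulr_ge0 ?(ltW Fn) //; lra.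
  by rewrite ltr_wpDl ?mulr_gt0 ?mulr_ge0 ?(ltW Fp) //; lra.
suff -> : (s + u) * (s * (s + q) ^+ 2 - (p * s + r) ^+ 2) +
           (s - u) * (s * (s - q) ^+ 2 - (p * s - r) ^+ 2) =
    2 * s * (s * (s ^+ 2 + 2 * q * u + q ^+ 2) -
    (p ^+ 2 * s ^+ 2 + 2 * p * r * u + r ^+ 2)) by rewrite E subrr mulr0 ltxx.
by ring.
Qed.

(** * The quartic and its root between n and n + 1 *)

(** Coefficients by increasing degree, over any ring: the integers serve integrality, the rationals
    divisibility, [R] and [R[i]] the roots. *)
Definition quartic (K : nzRingType) (n : nat) : {poly K} :=
  Poly [:: -1; 1 - n%:R; 0; - n%:R; 1].

Lemma map_quartic (K L : nzRingType) (f : {rmorphism K -> L}) (n : nat) :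
  map_poly f (quartic K n) = quartic L n.
Proof.
by rewrite map_Poly /= rmorphN rmorphB rmorphN !rmorph1 rmorph0 rmorph_nat.
Qed.

Lemma horner_quartic (K : comNzRingType) (n : nat) (x : K) :
  (quartic K n).[x] = x ^+ 4 - n%:R * x ^+ 3 - (n%:R - 1) * x - 1.
Proof. by rewrite horner_Poly /=; ring. Qed.

Lemma quartic_monic (K : nzRingType) (n : nat) : quartic K n \is monic.
Proof.
by apply/monicP; rewrite /lead_coef (@PolyK _ 0) //= oner_eq0.
Qed.

(** Intermediate values: the quartic is - (n ^ 2 - n + 1) at n and (n + 1) ^ 3 - n ^ 2 at n + 1. *)
Lemma quartic_root_exists (R : rcfType) (n : nat) :
  (0 < n)%N -> exists2 b : R, n%:R < b < n%:R + 1 & root (quartic R n) b.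
Proof.
move=> n0; have n1 : 1 <= n%:R :> R by rewrite ler1n.
have lo : (quartic R n).[n%:R] < 0 by rewrite horner_quartic; nra.
have hi : 0 < (quartic R n).[n%:R + 1].
  by rewrite horner_quartic; set c := n%:R in n1 *; nra.
have [||b /andP[bl br] rb] := @poly_ivt R (quartic R n) n%:R (n%:R + 1).
- by rewrite lerDl.
- by rewrite !ltW.
exists b => //; rewrite !lt_neqAle -!andbA; apply/and4P; split => //.
  by apply/eqP => e; move: lo; rewrite e (rootP rb) ltxx.
by apply/eqP => e; move: hi; rewrite -e (rootP rb) ltxx.
Qed.

(* For c = n, the T_b-orbit of 1 is 1, p, q, r, 0. *)
Lemma quartic_root_orbit (R : realFieldType) (c b : R) :
  2 <= c -> c < b < c + 1 -> b ^+ 4 - c * b ^+ 3 - (c - 1) * b - 1 = 0 ->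
  let p := b - c in let q := b * p in let r := b^-1 in
  [/\ b * q = c - 1 + r, b * r = 1, b * (b * (q + r - 1)) = 1 - q,
      0 < p < r & [/\ r < q < 1, 0 < q + r - 1 < p & p + q < 1]].
Proof.
move=> c2 /andP[cb bc] E p q r.
have b0 : 0 < b by lra.
have r0 : 0 < r by rewrite invr_gt0.
have br : b * r = 1 by rewrite mulfV ?gt_eqF.
have r1 : r < 1 by rewrite invf_lt1 //; lra.
have bq : b * q = c - 1 + r.
  (* The quartic equation divided by [b]. *)
  have e : b * q - (c - 1) - r =
      r * (b ^+ 4 - c * b ^+ 3 - (c - 1) * b - 1) + (1 - b * r) * (b * q - (c - 1)).
    by rewrite /q /p; ring.
  by move: e; rewrite E br subrr mulr0 mul0r addr0; lra.
have q1 : q < 1 by rewrite -(ltr_pM2l b0) bq; lra.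
have rq : r < q by rewrite -(ltr_pM2l b0) br bq; lra.
have p0 : 0 < p by rewrite subr_gt0.
have rp : r - p = (1 - q) * r.
  by rewrite mulrBl mul1r /q mulrAC br mul1r.
have rp0 : 0 < (1 - q) * r by rewrite mulr_gt0 // subr_gt0.
have qrp : (1 - q) * r < 1 - q by rewrite gtr_pMr // subr_gt0.
(* The orbit of (n + 1) / b ^ 2 enters its cycle at [q + r - 1]; the next two points are [r - p] and
   [1 - q]. *)
have bqr : b * (q + r - 1) = r - p by rewrite mulrBr mulrDr bq br /p; ring.
have bbqr : b * (b * (q + r - 1)) = 1 - q by rewrite bqr mulrBr br.
have u0 : 0 < q + r - 1 by rewrite -(pmulr_rgt0 _ b0) bqr rp.
(* This is [p + q < 1], and holds because multiplication by [b > 1] increases [q + r - 1]. *)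
have u1 : q + r - 1 < r - p.
  by rewrite -bqr -subr_gt0 -{2}[_ - 1]mul1r -mulrBl mulr_gt0 //; lra.
by split=> //; [lra|split=> //; lra].
Qed.

(** * Computing orbits and detecting infinitely many digits *)

Lemma beta_transform_step (R : realType) (b x y : R) (n : nat) :
  0 <= y < 1 -> b * x = n%:R + y ->
  Num.floor (b * x) = n%:Z /\ beta_transform b x = y.
Proof.
move=> y01 e; have f : Num.floor (b * x) = n%:Z.
  by apply: floor_def; rewrite e intrD !pmulrn; lra.
by split=> //; rewrite /beta_transform f e; lra.
Qed.

(** Digit k + 1 is read off the k-th iterate, which is a fixed point of the P-th iterate of the
    map. *)
Lemma beta_digit_periodic (R : realType) (b x : R) (k P j : nat) :
  iter (P + k) (beta_transform b) x = iter k (beta_transform b) x ->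
  beta_digit b x (j * P + k).+1 = beta_digit b x k.+1.
Proof.
move=> e; rewrite /beta_digit /= [iter (_ + _) _ _]iterD iterM.
by rewrite iter_fix // -iterD.
Qed.

Lemma infinite_set_unbounded (A : set nat) (f : nat -> nat) :
  (forall j, (j <= f j)%N) -> (forall j, A (f j)) -> infinite_set A.
Proof.
move=> lef Af /finite_seqP[s As].
have := Af (\max_(i <- s) i).+1; rewrite As /= => /leq_bigmax_seq.
by move=> /(_ xpredT id isT); rewrite leqNgt (leq_trans _ (lef _)).
Qed.

(** * The root as a CE-Pisot number violating the condition *)

Section QuarticRoot.
Context (R : realType) (n : nat) (b : R).
Hypotheses (n_gt1 : (1 < n)%N) (nb : n%:R < b < n%:R + 1).
Hypothesis root_b : root (quartic R n) b.

Let p := b - n%:R.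
Let q := b * p.
Let r := b^-1.

Let orbit : [/\ b * q = n%:R - 1 + r, b * r = 1,
  b * (b * (q + r - 1)) = 1 - q,
  0 < p < r & [/\ r < q < 1, 0 < q + r - 1 < p & p + q < 1]].
Proof.
apply: quartic_root_orbit => //; first by rewrite ler_nat.
by rewrite -horner_quartic (rootP root_b).
Qed.

Let n_pred : n.-1%:R = n%:R - 1 :> R.
Proof. by rewrite -subn1 natrB // ltnW. Qed.

Lemma quartic_root_pisot : pisot b.
Proof.
have [bq br _ /andP[p0 pr] [/andP[rq q1] /andP[qr qrp] pq]] := orbit.
have n2 : 2 <= n%:R :> R by rewrite ler_nat.
split; first by case/andP: nb; lra.
  by exists (quartic int n); rewrite ?quartic_monic ?map_quartic.
move=> z [P [_ P_irr Pb Pz]] zb.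
have Pf : P %| quartic rat n.
  by apply: irreducible_common_root_dvdp P_irr Pb _; rewrite map_quartic.
have zf : root (quartic R[i] n) z.
  rewrite -(map_quartic _ _ (@ratr R[i])).
  by apply: root_dvdp Pz; rewrite dvdp_map.
apply: (@cubic_root_normc_lt1 _ p q r).
- by lra.
- by lra.
- by lra.
- by rewrite ltr_norml; lra.
- by lra.
have fE : z ^+ 4 - n%:R * z ^+ 3 - (n%:R - 1) * z - 1 =
  (z - b%:C%C) * (z ^+ 3 + p%:C%C * z ^+ 2 + q%:C%C * z + r%:C%C).
  have nE : n%:R = b%:C%C - p%:C%C by rewrite -rmorphB subKr rmorph_nat.
  have qE : q%:C%C = b%:C%C * p%:C%C by rewrite -rmorphM.
  have bqE : n%:R - 1 = b%:C%C * q%:C%C - r%:C%C.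
    by rewrite -rmorphM bq -rmorphB addrK rmorphB rmorph1 rmorph_nat.
  have brE : 1 = b%:C%C * r%:C%C by rewrite -rmorphM br rmorph1.
  by rewrite bqE nE brE qE; ring.
move/rootP: zf; rewrite horner_quartic fE => /eqP.
by rewrite mulf_eq0 subr_eq0 (negbTE zb) => /eqP.
Qed.

Lemma quartic_root_digits_one :
  [/\ beta_digit b 1 1 = n, beta_digit b 1 2 = 0, beta_digit b 1 3 = n.-1,
      beta_digit b 1 4 = 1 & forall k, (4 < k)%N -> beta_digit b 1 k = 0].
Proof.
have [bq br _ /andP[p0 pr] [/andP[rq q1] /andP[qr qrp] pq]] := orbit.
have [||d1 t1] := @beta_transform_step _ b 1 p n; [lra|rewrite /p; lra|].
have [||d2 t2] := @beta_transform_step _ b p q 0; [lra|rewrite /q; lra|].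
have [||d3 t3] := @beta_transform_step _ b q r n.-1; [lra|rewrite n_pred; lra|].
have [||d4 t4] := @beta_transform_step _ b r 0 1; [lra|lra|].
have [||d5 t5] := @beta_transform_step _ b 0 0 0; [lra|lra|].
rewrite /beta_digit /= t1 t2 t3; split=> // k k4.
rewrite -(subnK k4) addnS /= iterD /= t1 t2 t3 t4 iter_fix //.
Qed.

Lemma quartic_root_CE : CE_pisot b.
Proof.
have [d1 d2 d3 d4 d5] := quartic_root_digits_one.
split; first exact: quartic_root_pisot.
exists 4%N; split.
- by split=> //; rewrite d4.
(* The digits fall from n to 0 and then rise to n - 1 >= 1. *)
- rewrite /monotonic /= d1 d2 d3 d4; lia.
by exists 2.
Qed.

Lemma quartic_root_Fin_one : beta_Fin b 1.
Proof.
have [_ _ _ _ d5] := quartic_root_digits_one.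
split=> //; exists 0; first by split; rewrite ?expr0.
apply: sub_finite_set (finite_II 5) => k [_] /=; rewrite expr0 divr1.
by apply: contra_neqT; rewrite -leqNgt; exact: d5.
Qed.

(* The digits of n + 1 are 1 0 . (n-1) 1 (n-1), followed by 0 0 0 (n-1) n
   repeated forever. *)
Lemma quartic_root_digits_succ :
  forall j, beta_digit b (n.+1%:R / b ^+ 2) (j * 5 + 10) = n.
Proof.
have [bq br bbqr /andP[p0 pr] [/andP[rq q1] /andP[qr qrp] pq]] := orbit.
have n2 : 2 <= n%:R :> R by rewrite ler_nat.
have bE : b = n%:R + p by rewrite /p; ring.
have bp : b * p = q by [].
have r1 : r < 1 by lra.
have rp1 : 0 < r * (1 - p) < 1.
  have rp0 : 0 < r * p by rewrite mulr_gt0 //; lra.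
  by rewrite mulr_gt0; lra.
have u6 : 0 < b * (q + r - 1) < 1.
  have u0 : 0 < b * (q + r - 1) by rewrite mulr_gt0 //; lra.
  (* Gives b (q + r - 1) < b ^ 2 (q + r - 1) = 1 - q < 1. *)
  have : 0 < (b - 1) * (b * (q + r - 1)) by rewrite mulr_gt0 //; lra.
  by lra.
set x := _ / _.
(* Substitute n + 1 = b + 1 - p in (n + 1) / b. *)
have xE : b * x = 1 + r * (1 - p).
  have b0 : b != 0 by apply/eqP; lra.
  by rewrite /x /p /r -natr1; field.
have step := @beta_transform_step R b.
have [||_ t0] := step x (r * (1 - p)) 1%N; [lra|lra|].
have [||_ t1] := step (r * (1 - p)) (1 - p) 0%N; [lra|rewrite mulrA br; lra|].
have [||_ t2] := step (1 - p) (1 + p - q) n.-1; [lra|rewrite n_pred; lra|].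
have [||_ t3] := step (1 + p - q) (p + q - r) 1%N; [lra|lra|].
have [||_ t4] := step (p + q - r) (q + r - 1) n.-1; [lra|rewrite n_pred; lra|].
have [||_ t5] := step (q + r - 1) (b * (q + r - 1)) 0%N; [lra|lra|].
have [||_ t6] := step (b * (q + r - 1)) (1 - q) 0%N; [lra|lra|].
have [||_ t7] := step (1 - q) (1 + p - r) 0%N; [lra|lra|].
have [||_ t8] := step (1 + p - r) (p + q) n.-1; [lra|rewrite n_pred; lra|].
(* Back at the image found in [t4]: the cycle has length 5. *)
have [||d9 t9] := step (p + q) (q + r - 1) n; [lra|lra|].
move=> j; rewrite addnS beta_digit_periodic /beta_digit /=;
  by rewrite t0 t1 t2 t3 t4 t5 t6 t7 t8 // t9 t5 t6 t7 t8.
Qed.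

Lemma quartic_root_not_F1 : ~ condition_F1 b.
Proof.
have /andP[nb1 bn1] := nb; have n2 : 2 <= n%:R :> R by rewrite ler_nat.
move=> /(_ n.+1%:R (ex_intro2 _ _ n.+1 I erefl))[_ [L [nL minL]]].
(* Indeed b < n + 1 <= b ^ 2, as n >= 2. *)
have -> : L = 2.
  apply/eqP; rewrite eqn_leq minL /=; last first.
    by rewrite -natr1; nra.
  by case: L nL {minL} => [|[|L]] //; rewrite ?expr0 ?expr1 -natr1; lra.
apply: (@infinite_set_unbounded _ (fun j => j * 5 + 10)%N) => j; first lia.
by rewrite /= addn_gt0 orbT quartic_root_digits_succ; split=> //; lia.
Qed.

End QuarticRoot.

Theorem theorem1p1 (R : realType) :
  infinite_set [set b : R | [/\ CE_pisot b, beta_Fin b 1 & ~ condition_F1 b]].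
Proof.
move=> /finite_seqP[s sE].
have [N ltN] : exists N : nat, forall x, x \in s -> x < N%:R.
  exists (\max_(x <- s) Num.bound `|x|)%N => x xs.
  apply: le_lt_trans (ler_norm x) _; apply: lt_le_trans (archi_boundP _) _ => //.
  by rewrite ler_nat; apply: leq_bigmax_seq xs isT.
(* The parameter N + 2 is at least 2 and puts [b] above every element of [s]. *)
have [b /andP[nb bn] rb] := @quartic_root_exists R N.+2 isT.
have : b \in s.
  have : [set` s] b by rewrite -sE; split;
    [apply: (@quartic_root_CE _ N.+2)|apply: (@quartic_root_Fin_one _ N.+2)|
     apply: (@quartic_root_not_F1 _ N.+2)] => //; rewrite nb bn.
  by [].
by move=> /ltN; rewrite ltNge (le_trans _ (ltW nb)) // ler_nat leqW // leqW.
Qed.
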